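(* Let $G$ be a finite connected simple graph with $n$ vertices and $m$ edges, and let $k\ge 1$ be an integer. Then \[HM(R_k(G))=(k+1)^2HM(G)+k(k+1)^2F(G)+4k(k+1)M_1(G)+8km.\]
   Context: For a graph $H$ and vertex $v$, $d_H(v)$ denotes the degree of $v$ in $H$. Define $M_1(H)=\sum_{v\in V(H)} d_H(v)^2$, $F(H)=\sum_{v\in V(H)} d_H(v)^3$ and $HM(H)=\sum_{uv\in E(H)}(d_H(u)+d_H(v))^2$. The $k$-th semi total point graph $R_k(G)$ is obtained from $G$ by adding, for each edge $uv$ of $G$, $k$ new vertices (distinct for distinct edges) and joining each of them to both $u$ and $v$ (the edges of $G$ are kept). *)

(* Defs.v *)
From mathcomp Require Import all_boot.

Set Implicit Arguments.
Unset Strict Implicit.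
Unset Printing Implicit Defensive.

Record sgraph := SGraph {
  vertex :> finType;
  adj : rel vertex;
  adj_sym : symmetric adj;
  adj_irrefl : irreflexive adj
}.

Definition edges (G : sgraph) : {set {set G}} :=
  [set e | [exists u, exists v, adj u v && (e == [set u; v])]].

(* The graph with no vertex counts as connected here. *)
Definition connected (G : sgraph) : Prop :=
  forall u v : G, connect (@adj G) u v.

Definition deg (G : sgraph) (v : G) : nat := #|[set w | adj v w]|.

Definition M1 (G : sgraph) : nat := \sum_(v : G) deg v ^ 2.

Definition forgotten_index (G : sgraph) : nat := \sum_(v : G) deg v ^ 3.

(* An edge e is a set {u, v} with u and v distinct, since adj is irreflexive,
   so the inner sum is deg u + deg v. *)
Definition HM (G : sgraph) : nat :=
  \sum_(e in edges G) (\sum_(v in e) deg v) ^ 2.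

Section SemiTotalPoint.
Variables (k : nat) (G : sgraph).

(* inr (e, i) is the i-th of the k new vertices attached to the edge e. *)
Definition Rk_vertex : finType := (G + {e : {set G} | e \in edges G} * 'I_k)%type.

Definition Rk_adj : rel Rk_vertex := fun x y =>
  match x, y with
  | inl u, inl v => adj u v
  | inl u, inr (e, _) => u \in val e
  | inr (e, _), inl u => u \in val e
  | inr _, inr _ => false
  end.

Lemma Rk_adj_sym : symmetric Rk_adj.
Proof. by move=> [u|[e i]] [v|[f j]] //=; rewrite adj_sym. Qed.

Lemma Rk_adj_irrefl : irreflexive Rk_adj.
Proof. by move=> [u|[e i]] //=; rewrite adj_irrefl. Qed.

Definition Rk : sgraph := SGraph Rk_adj_sym Rk_adj_irrefl.

End SemiTotalPoint.

(* Main.v *)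
Require Import Defs.
From mathcomp Require Import all_boot.
From mathcomp Require Import ring.

(** Summing over ordered pairs of adjacent vertices counts every edge twice, so
    [2 HM] is a sum over such pairs. In [R_k(G)] an old vertex [u] has degree
    [(k + 1) d(u)] and a new one has degree 2; hence the old edges contribute
    [(k + 1)^2 HM(G)], and the [k d(u)] new edges at [u] contribute
    [k d(u) ((k + 1) d(u) + 2)^2], which expands into the remaining terms by
    the handshake identity [sum d(u) = 2 m]. *)

Lemma adj_neq {G : sgraph} {u v : G} : adj u v -> u != v.
Proof. by apply: contraTneq => ->; rewrite adj_irrefl. Qed.

Lemma edgesP {G : sgraph} {e : {set G}} :
  reflect (exists u v, adj u v /\ e = [set u; v]) (e \in edges G).
Proof.
rewrite inE; apply: (iffP existsP) => [[u /existsP[v /andP[uv /eqP->]]]|].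
  by exists u, v.
move=> [u [v [uv ->]]]; exists u; apply/existsP; exists v.
by rewrite uv eqxx.
Qed.

Lemma card_edge (G : sgraph) (e : {set G}) : e \in edges G -> #|e| = 2.
Proof. by move=> /edgesP[u [v [uv ->]]]; rewrite cards2 adj_neq. Qed.

Lemma incident_edges (G : sgraph) (u : G) :
  [set e in edges G | u \in e] = [set [set u; v] | v in [set v | adj u v]].
Proof.
apply/setP => e; rewrite inE; apply/andP/imsetP => [[/edgesP[a [b [ab ->]]]]|].
  rewrite !inE => /orP[] /eqP->; first by exists b; rewrite ?inE.
  by exists a; rewrite ?inE 1?adj_sym // setUC.
move=> [v]; rewrite inE => uv ->; split; last by rewrite set21.
by apply/edgesP; exists u, v.
Qed.

Lemma sum_incident (G : sgraph) (u : G) (F : {set G} -> nat) :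
  \sum_(e in edges G | u \in e) F e = \sum_(v | adj u v) F [set u; v].
Proof.
transitivity (\sum_(e in [set e in edges G | u \in e]) F e).
  by apply: eq_bigl => e; rewrite inE.
rewrite incident_edges big_imset /=; first by apply: eq_bigl => v; rewrite inE.
(* The map sending [v] to [[set u; v]] is injective on neighbours of [u]: as [v] differs from [u],
   its membership in [[set u; w]] forces [v = w]. *)
move=> v w; rewrite !inE => uv _ /setP/(_ v).
by rewrite !inE eqxx orbT eq_sym (negPf (adj_neq uv)) => /esym/eqP.
Qed.

Lemma sum_adj (G : sgraph) (F : {set G} -> nat) :
  \sum_(u : G) \sum_(v | adj u v) F [set u; v] = 2 * \sum_(e in edges G) F e.
Proof.
under eq_bigr do rewrite -sum_incident.
rewrite (exchange_big_dep (mem (edges G))) /= => [|u e _ /andP[]//].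
rewrite big_distrr /=.
(* The factor 2 is read as [#|e|]: after the exchange, [e] contributes [F e] once per endpoint. *)
apply: eq_bigr => e eG; rewrite -(card_edge _ _ eG) -sum_nat_const.
by apply: eq_bigl => u; rewrite eG.
Qed.

Lemma degE (G : sgraph) (u : G) : deg u = \sum_(v | adj u v) 1.
Proof. by rewrite sum1_card /deg cardsE. Qed.

Lemma sum_deg (G : sgraph) : \sum_(u : G) deg u = 2 * #|edges G|.
Proof.
by under eq_bigr do rewrite degE; rewrite (sum_adj G (fun=> 1)) sum1_card.
Qed.

Lemma double_HM (G : sgraph) :
  2 * HM G = \sum_(u : G) \sum_(v | adj u v) (deg u + deg v) ^ 2.
Proof.
rewrite -sum_adj; apply: eq_bigr => u _; apply: eq_bigr => v uv.
by rewrite big_setU1 ?big_set1 // inE adj_neq.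
Qed.

Section SemiTotalPointGraph.
Variables (G : sgraph) (k : nat).

Lemma sum_new_incident (u : G) (c : nat) :
  \sum_(x : {e : {set G} | e \in edges G} * 'I_k | u \in val x.1) c =
  k * deg u * c.
Proof.
transitivity (\sum_(e : {e : {set G} | e \in edges G} | u \in val e)
                 \sum_(i < k) c).
  by rewrite pair_big; apply: eq_bigl => x; rewrite andbT.
under eq_bigr do rewrite sum_nat_const card_ord.
have <- := big_sub_cond (edges G) (fun e : {set G} => u \in e) (fun=> k * c).
rewrite sum_incident sum_nat_const -[#|_|]cardsE.
by rewrite -/(deg u) mulnCA mulnA.
Qed.

(** Each of the [deg u] edges at [u] carries [k] new neighbours. A constant value on new vertices is
    enough: [F] is used as 1, to get degrees, and as a function of the degree, which is 2 at every
    new vertex. *)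
Lemma sum_adj_old (u : G) (F : Rk k G -> nat) (c : nat) :
    (forall x, F (inr x) = c) ->
  \sum_(x : Rk k G | adj (inl u : Rk k G) x) F x =
  \sum_(v | adj u v) F (inl v) + k * deg u * c.
Proof.
move=> Fc; rewrite big_sumType -sum_new_incident /=; congr (_ + _).
by apply: eq_big => [[]|].
Qed.

Lemma sum_adj_new (x : {e : {set G} | e \in edges G} * 'I_k)
    (F : Rk k G -> nat) :
  \sum_(y : Rk k G | adj (inr x : Rk k G) y) F y = \sum_(v in val x.1) F (inl v).
Proof. 
case: x => e i.
by rewrite big_sumType /= [X in _ + X]big_pred0 ?addn0.
Qed.

Lemma deg_old (u : G) : deg (inl u : Rk k G) = (k + 1) * deg u.
Proof. by rewrite degE (@sum_adj_old u _ 1) // -degE; ring. Qed.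

Lemma deg_new (x : {e : {set G} | e \in edges G} * 'I_k) :
  deg (inr x : Rk k G) = 2.
Proof. by rewrite degE sum_adj_new sum1_card card_edge ?(valP x.1). Qed.

End SemiTotalPointGraph.

Theorem theorem2p13 (G : sgraph) (n m k : nat)
    (hconn : connected G) (hn : #|G| = n) (hm : #|edges G| = m) (hk : 1 <= k) :
  HM (Rk k G) =
    (k + 1) ^ 2 * HM G + k * (k + 1) ^ 2 * forgotten_index G
    + 4 * k * (k + 1) * M1 G + 8 * k * m.
Proof.
(* Both sides are doubled so that [double_HM] applies. *)
apply/eqP; rewrite -(eqn_pmul2l (isT : 0 < 2)); apply/eqP.
have old u : \sum_(x : Rk k G | adj (inl u : Rk k G) x)
    (deg (inl u : Rk k G) + deg x) ^ 2 =
    (k + 1) ^ 2 * (\sum_(v | adj u v) (deg u + deg v) ^ 2) +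
    k * deg u * ((k + 1) * deg u + 2) ^ 2.
  rewrite (@sum_adj_old _ _ _ _ (((k + 1) * deg u + 2) ^ 2)) => [|x].
    congr (_ + _); rewrite big_distrr /=; apply: eq_bigr => v _.
    by rewrite !deg_old -mulnDr expnMn.
  by rewrite deg_old deg_new.
have new : \sum_x \sum_(y : Rk k G | adj (inr x : Rk k G) y)
    (deg (inr x : Rk k G) + deg y) ^ 2 =
    \sum_(u : G) k * deg u * ((k + 1) * deg u + 2) ^ 2.
  under eq_bigr => x _ do rewrite sum_adj_new.
  (* The new edges, seen from their new ends, are regrouped by their old end, which gives the same
     sum as in [old]. *)
  rewrite (exchange_big_dep predT) //=; apply: eq_bigr => u _.
  rewrite -sum_new_incident; apply: eq_bigr => x _.
  by rewrite deg_old deg_new addnC.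
rewrite double_HM big_sumType /= new.
under eq_bigr do rewrite old.
rewrite big_split /= -big_distrr -double_HM /=.
(* This sum now occurs twice, once for each orientation of the new edges, which matches the
   doubling. Its linear term [4 * k * deg u] yields the summand in [m] through [sum_deg]. *)
have -> : \sum_(u : G) k * deg u * ((k + 1) * deg u + 2) ^ 2 =
    k * (k + 1) ^ 2 * forgotten_index G + 4 * k * (k + 1) * M1 G
    + 4 * k * (2 * m).
  rewrite -hm -sum_deg /forgotten_index /M1 !big_distrr -!big_split /=.
  by apply: eq_bigr => u _; ring.
ring.
Qed.
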